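(* Let $A$ and $B$ be arbitrary non-empty sets, and let $\mathcal{T}$ be a set of $A$-to-$B$ relational constraints. Then the following are equivalent: (i) $\mathcal{T}$ is locally closed, contains the unary empty constraint $(\emptyset,\emptyset)$, the unary trivial constraint $(A,B)$ and the binary equality constraint $(=_A,=_B)$, and is closed under formation of weak conjunctive minors; (ii) $\mathcal{T}$ is characterized by some set of partial functions on $A$ to $B$.
   Context: Conventions: $n,m,\dots$ denote positive integers, viewed as ordinals $n=\{0,\dots,n-1\}$; an $m$-tuple over $A$ is a map $m\to A$. An $m$-ary relation on $A$ is a subset of $A^m$; empty relations of different arities are regarded as distinct. $=_A$ and $=_B$ denote the (binary) equality relations on $A$ and $B$. Functions: an $n$-ary multivalued function on $A$ to $B$ is a map $f:A^n\to\mathcal{P}(B)$, where $\mathcal{P}(B)$ is the set of all subsets of $B$; it is a partial function on $A$ to $B$ if for every $\mathbf{a}\in A^n$ the set $f(\mathbf{a})$ is empty or a singleton. For $\mathbf{a}^1,\dots,\mathbf{a}^n\in A^m$, let $f(\mathbf{a}^1\ldots\mathbf{a}^n)=\prod_{i\in m}f(\mathbf{a}^1(i),\dots,\mathbf{a}^n(i))\subseteq B^m$, and for $R\subseteq A^m$ let $fR=\bigcup\{f(\mathbf{a}^1\ldots\mathbf{a}^n):\mathbf{a}^1,\dots,\mathbf{a}^n\in R\}$. Constraints: an $m$-ary $A$-to-$B$ (relational) constraint is an ordered pair $(R,S)$ with $R\subseteq A^m$ (antecedent) and $S\subseteq B^m$ (consequent); $f$ satisfies $(R,S)$ if $fR\subseteq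 S$. A set $\mathcal{T}$ of $A$-to-$B$ constraints (of various finite arities) is characterized by a set $\mathcal{M}$ of multivalued functions (of various arities) if $\mathcal{T}$ is exactly the set of all $A$-to-$B$ constraints satisfied by every function in $\mathcal{M}$. Weak conjunctive minors: an $m$-ary constraint $(R,S)$ is a weak conjunctive minor of a non-empty family $(R_j,S_j)_{j\in J}$ of constraints, with $(R_j,S_j)$ of arity $n_j$, if there are maps $h_j:n_j\to m$ ($j\in J$) such that for all $\mathbf{a}\in A^m$, $\mathbf{b}\in B^m$: (a) if $\mathbf{a}\in R$ then $\mathbf{a}\circ h_j\in R_j$ for all $j\in J$; and (b) if $\mathbf{b}\circ h_j\in S_j$ for all $j\in J$ then $\mathbf{b}\in S$. $\mathcal{T}$ is closed under formation of weak conjunctive minors if every weak conjunctive minor of any non-empty family of members of $\mathcal{T}$ is in $\mathcal{T}$. Local closure: $(R',S')$ is a relaxation of $(R,S)$ (of the same arity) if $R'\subseteq R$ and $S'\supseteq S$; it is a finite relaxation if moreover $R'$ is finite. $\mathcal{T}$ is locally closed if it contains every $A$-to-$B$ constraint all of whose finite relaxations belong to $\mathcal{T}$. *)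

(* Defs.v *)
From mathcomp Require Import all_boot.
From mathcomp Require Import boolp classical_sets cardinality.

Set Implicit Arguments.
Unset Strict Implicit.
Unset Printing Implicit Defensive.

Local Open Scope classical_set_scope.

(* All arities are positive, and an m-tuple over A is a map 'I_m -> A. *)

Record mvfun (A B : Type) := MVFun {
  fun_arity : nat;
  fun_arity_gt0 : (0 < fun_arity)%N;
  mvfun_val :> ('I_fun_arity -> A) -> set B
}.

Record constraint (A B : Type) := Constraint {
  arity : nat;
  arity_gt0 : (0 < arity)%N;
  antecedent : set ('I_arity -> A);
  consequent : set ('I_arity -> B)
}.

Arguments mvfun_val {A B} f _ _ : rename.
Arguments antecedent {A B} c _ : rename.
Arguments consequent {A B} c _ : rename.

Section Constraints.
Variables A B : Type.
Implicit Types (f : mvfun A B) (c d : constraint A B).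
Implicit Types (M : set (mvfun A B)) (T : set (constraint A B)).

Definition is_partial f :=
  forall a : 'I_(fun_arity f) -> A, f a = set0 \/ exists b, f a = [set b].

(* The product of the sets f (a^1(i), ..., a^n(i)) over i < m, as a set of
   m-tuples. *)
Definition mvapply f (m : nat) (a : 'I_(fun_arity f) -> 'I_m -> A) : set ('I_m -> B) :=
  [set b | forall i : 'I_m, f (fun k => a k i) (b i)].

Definition mvimage f (m : nat) (R : set ('I_m -> A)) : set ('I_m -> B) :=
  \bigcup_(a in [set a : 'I_(fun_arity f) -> 'I_m -> A | forall k, R (a k)])
    mvapply a.

Definition satisfies f c := mvimage f (antecedent c) `<=` consequent c.

Definition characterized_by T M :=
  T = [set c | forall f, M f -> satisfies f c].

Definition weak_conj_minor (J : Type) (cj : J -> constraint A B) d :=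
  exists h : forall j, 'I_(arity (cj j)) -> 'I_(arity d),
    forall (a : 'I_(arity d) -> A) (b : 'I_(arity d) -> B),
      (antecedent d a -> forall j, antecedent (cj j) (a \o h j)) /\
      ((forall j, consequent (cj j) (b \o h j)) -> consequent d b).

Definition wcm_closed T :=
  forall (J : Type) (cj : J -> constraint A B),
    inhabited J -> (forall j, T (cj j)) ->
    forall d, weak_conj_minor cj d -> T d.

(* The equation forces d to have the same arity as c. *)
Definition relaxation c d :=
  exists R S, [/\ d = Constraint (arity_gt0 c) R S,
                  R `<=` antecedent c & consequent c `<=` S].

Definition finite_relaxation c d :=
  relaxation c d /\ finite_set (antecedent d).

Definition locally_closed T :=
  forall c, (forall d, finite_relaxation c d -> T d) -> T c.

Definition empty_constraint : constraint A B :=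
  @Constraint A B 1 isT set0 set0.

Definition trivial_constraint : constraint A B :=
  @Constraint A B 1 isT setT setT.

Definition eq_constraint : constraint A B :=
  @Constraint A B 2 isT [set a | a ord0 = a ord_max]
                        [set b | b ord0 = b ord_max].

End Constraints.

(* Main.v *)
Require Import Defs.
From mathcomp Require Import all_boot.
From mathcomp Require Import boolp classical_sets cardinality.

(* If [(R, S)] is a constraint whose finite antecedent [R] is enumerated by
   [a^1, ..., a^n], then each [b] outside [S] determines the function [f_b] of
   arity [n] sending the row [(a^1(i), ..., a^n(i))] to all [b(j)] with [j] an
   index of the same row; [f_b] violates [(R, S)]. If every such [f_b] violated
   a member [(R_b, S_b)] of [T], the violation would give a map [h_b] into the
   index set of [(R, S)], and these maps would exhibit [(R, S)] as a weak
   conjunctive minor of the family [(R_b, S_b)]. A multivalued function is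
   partial exactly when it satisfies the equality constraint, so a good [f_b]
   is automatically partial. *)

Set Implicit Arguments.
Unset Strict Implicit.
Unset Printing Implicit Defensive.

Local Open Scope classical_set_scope.

Section Preservation.
Context {A B : Type}.
Implicit Types (f : mvfun A B) (c d : constraint A B).

Lemma satisfiesP f c :
  satisfies f c <->
  forall (a : 'I_(fun_arity f) -> 'I_(arity c) -> A) b,
    (forall k, antecedent c (a k)) ->
    (forall i, f (fun k => a k i) (b i)) -> consequent c b.
Proof.
split=> [fc a b aR fab|fc b [a aR fab]]; last exact: fc aR fab.
by apply: fc; exists a.
Qed.

Lemma satisfies_relaxation f c d :
  relaxation c d -> satisfies f c -> satisfies f d.
Proof.
move=> [R [S [-> RR SS]]] /satisfiesP fc; apply/satisfiesP => a b aR fab.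
by apply: SS; apply: fc fab => k; exact: RR (aR k).
Qed.

Lemma satisfies_empty f : satisfies f (empty_constraint A B).
Proof. by apply/satisfiesP => a b /(_ (Ordinal (fun_arity_gt0 f))). Qed.

Lemma satisfies_trivial f : satisfies f (trivial_constraint A B).
Proof. exact/satisfiesP. Qed.

Lemma satisfies_eq f : satisfies f (eq_constraint A B) <-> is_partial f.
Proof.
split=> [/satisfiesP feq r|fp].
  have [[x fx]|nfx] := pselect (exists x, f r x); last first.
    by left; rewrite -subset0 => x fx; apply: nfx; exists x.
  right; exists x; apply/seteqP; split=> [y fy|_ ->//].
  (* Repeating [r] in both coordinates gives pairs in equality over [A], so any two values of [f] at
     [r] must agree. *)
  apply: (feq (fun k _ => r k) (fun i => if i == ord0 then y else x)) => //= i.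
  by case: ifP.
apply/satisfiesP => a b /= aeq fab.
have := fab ord_max; have := fab ord0.
have -> : (fun k => a k ord0) = (fun k => a k ord_max) by apply/funext.
by case: (fp (fun k => a k ord_max)) => [->//|[x ->]] /= -> ->.
Qed.

Lemma satisfies_wcm f (J : Type) (cj : J -> constraint A B) d :
  (forall j, satisfies f (cj j)) -> weak_conj_minor cj d -> satisfies f d.
Proof.
move=> fcj [h hP]; apply/satisfiesP => a b aR fab.
(* The second half of [hP] does not depend on the tuple over [A]; positive arity supplies one. *)
apply: (hP (a (Ordinal (fun_arity_gt0 f))) b).2 => j.
apply: ((satisfiesP _ _).1 (fcj j)); last by move=> i; apply: fab.
by move=> k; apply: (hP (a k) b).1.
Qed.

(** A violation involves only the finitely many tuples [a k], so cutting the antecedent down to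
    [range a] preserves it. *)
Lemma satisfies_finite_relaxations f c :
  (forall d, finite_relaxation c d -> satisfies f d) -> satisfies f c.
Proof.
move=> fc; apply/satisfiesP => a b aR fab.
apply: ((satisfiesP _ (Constraint (arity_gt0 c) (range a) _)).1 (fc _ _) a b _ fab).
  split; last exact: finite_image.
  by exists (range a), (consequent c); split=> // _ [k _ <-].
by move=> k; exists k.
Qed.

End Preservation.

Lemma finite_range {X : Type} (R : set X) (x : X) : finite_set R -> R x ->
  exists n (a : 'I_n.+1 -> X), R = range a.
Proof.
move=> /(@finite_seqP {classic X})[s ->]; case: s => // y s _.
exists (size s), (fun i => nth y (y :: s) i).
apply/seteqP; split=> [_ /(nthP y)[i si <-]|_ [i _ <-]].
  by exists (Ordinal si).
exact: mem_nth.
Qed.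

Section RowFunction.
Context {A B : Type} {n m : nat} (a : 'I_n.+1 -> 'I_m -> A) (b : 'I_m -> B).

Definition row_fun : mvfun A B :=
  @MVFun A B n.+1 isT (fun r => [set b i | i in [set i | r = fun k => a k i]]).

Lemma row_fun_violation (c : constraint A B) : ~ satisfies row_fun c ->
  exists h : 'I_(arity c) -> 'I_m,
    (forall k, antecedent c (a k \o h)) /\ ~ consequent c (b \o h).
Proof.
apply: contra_notP => nh; apply/satisfiesP => r s rR /= rs.
(* [h i] is an index whose row in [a] is the [i]-th row of [r] and at which [b] takes the value
   [s i]. *)
pose h i := s2val (cid2 (rs i)).
have -> : s = b \o h by apply/funext => i; rewrite /= (s2valP' (cid2 (rs i))).
apply: contrapT => nS; apply: nh; exists h; split=> // k.
have -> : a k \o h = r k; last exact: rR.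
by apply/funext => i; have /(congr1 (@^~ k)) := s2valP (cid2 (rs i)).
Qed.

End RowFunction.

Section Separation.
Context {A B : Type} {T : set (constraint A B)}.
Hypotheses (T0 : T (empty_constraint A B)) (T1 : T (trivial_constraint A B)).
Hypotheses (Teq : T (eq_constraint A B)) (Twcm : wcm_closed T).

Lemma finite_antecedent_mem (d : constraint A B) :
  finite_set (antecedent d) ->
  (forall f, is_partial f -> (forall c, T c -> satisfies f c) ->
    satisfies f d) ->
  T d.
Proof.
case: d => m m_gt0 R S /= Rfin dM.
(* An empty [R] cannot be enumerated with positive length; both minor conditions over the empty
   constraint are then vacuous. *)
have [[x Rx]|R0] := pselect (exists x, R x); last first.
  apply: (@Twcm _ (fun _ : unit => empty_constraint A B)) => //.
  exists (fun _ _ => Ordinal m_gt0) => y z /=; split=> [Ry|/(_ tt)//].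
  by case: R0; exists y.
(* The family below is indexed by the tuples outside [S], so a full [S] would leave it empty. *)
have [ST|/existsNP[b0 Sb0]] := pselect (forall b, S b).
  apply: (@Twcm _ (fun _ : unit => trivial_constraint A B)) => //.
  by exists (fun _ _ => Ordinal m_gt0) => y z /=; split.
have [n [a RE]] := finite_range Rfin Rx.
have viol (b : {b | ~ S b}) : exists c, T c /\ ~ satisfies (row_fun a (sval b)) c.
  case: b => b Sb /=; apply: contrapT => /forallNP nviol.
  have fT c : T c -> satisfies (row_fun a b) c.
    by move=> Tc; apply: contrapT => fc; apply: (nviol c).
  have fd := dM _ ((satisfies_eq _).1 (fT _ Teq)) fT.
  apply: Sb; apply: ((satisfiesP _ _).1 fd a b) => [k|i]; last by exists i.
  by rewrite /= RE; exists k.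
have [cj cjP] := choice viol.
pose h j := cid (row_fun_violation (cjP j).2).
apply: (@Twcm _ cj) => [|j|]; [by exists; exists b0|exact: (cjP j).1|].
exists (fun j => sval (h j)) => y z /=; split=> [|zS].
  by rewrite RE => -[k _ <-] j; apply: (svalP (h j)).1.
(* A tuple [z] outside [S] is itself an index, and its own member excludes [z] composed with its
   map. *)
apply: contrapT => Sz.
exact: ((svalP (h (exist _ z Sz))).2 (zS (exist _ z Sz))).
Qed.

End Separation.

Theorem corollary2 (A B : Type) (hA : inhabited A) (hB : inhabited B)
    (T : set (constraint A B)) :
  [/\ locally_closed T, T (empty_constraint A B), T (trivial_constraint A B),
      T (eq_constraint A B) & wcm_closed T]
  <->
  exists M : set (mvfun A B),
    (forall f, M f -> is_partial f) /\ characterized_by T M.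
Proof.
split=> [[Tloc T0 T1 Teq Twcm]|[M [Mp ->]]].
  (* This is the largest possible choice; local closure then reduces membership in [T] to finite
     antecedents. *)
  exists [set f | is_partial f /\ forall c, T c -> satisfies f c].
  split=> [f []//|]; apply/seteqP; split=> [c Tc f [_]|c cM]; first exact.
  apply: Tloc => d [cd dfin]; apply: finite_antecedent_mem => // f fp fT.
  by apply: satisfies_relaxation cd _; apply: cM.
split.
- move=> c cfin f Mf; apply: satisfies_finite_relaxations => d cd.
  exact: cfin cd f Mf.
- by move=> f _; apply: satisfies_empty.
- by move=> f _; apply: satisfies_trivial.
- by move=> f Mf; apply/satisfies_eq/Mp.
- move=> J cj _ cjM d cjd f Mf; apply: satisfies_wcm cjd => j.
  exact: cjM j f Mf.
Qed.
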